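(* Let $a=(a_n)_{n\in\mathbb{Z}}$ be a two-sided Pólya-frequency sequence. Then there exist two-sided Pólya-frequency sequences $a^{(r)}=(a^{(r)}_n)_{n\in\mathbb{Z}}$, $r=1,2,\ldots$, whose Toeplitz kernels are strictly totally positive of infinite order and such that $$a^{(r)}_n\to a_n \quad (r\to\infty)\qquad\text{for every } n\in\mathbb{Z}.$$ Thus totally positive Pólya-frequency sequences are dense in the set of Pólya-frequency sequences for the product topology on $\mathbb{R}^{\mathbb{Z}}$.
   Context: For a real two-sided sequence $a=(a_n)_{n\in\mathbb{Z}}$, its Toeplitz kernel is $T_a(i,j)=a_{i-j}$, $i,j\in\mathbb{Z}$. A kernel $K:X\times Y\to\mathbb{R}$ on totally ordered sets is totally nonnegative of infinite order ($\mathrm{TN}_\infty$) if $\det[K(x_i,y_j)]_{i,j=1}^m\ge0$ for every $m\ge1$, every $x_1<\cdots<x_m$ in $X$ and every $y_1<\cdots<y_m$ in $Y$; it is strictly totally positive of infinite order ($\mathrm{STP}_\infty$) if all these determinants are strictly positive. The sequence $a$ is a (two-sided) Pólya-frequency sequence if $T_a$ is $\mathrm{TN}_\infty$ on $\mathbb{Z}\times\mathbb{Z}$ (in particular the zero sequence is allowed), and a totally positive Pólya-frequency sequence if $T_a$ is $\mathrm{STP}_\infty$ on $\mathbb{Z}\times\mathbb{Z}$. The product topology on $\mathbb{R}^{\mathbb{Z}}$ is the topology of coordinatewise convergence. *)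

(* Defs.v *)
From HB Require Import structures.
From mathcomp Require Import all_boot all_order all_algebra.
From mathcomp Require Import all_classical all_reals all_analysis.

Set Implicit Arguments.
Unset Strict Implicit.
Unset Printing Implicit Defensive.

Import Order.TTheory GRing.Theory Num.Theory.
Import numFieldNormedType.Exports.

Local Open Scope classical_set_scope.
Local Open Scope ring_scope.

Definition strictly_increasing {d : Order.disp_t} {X : porderType d} {m : nat}
    (x : 'I_m -> X) : Prop :=
  forall i j : 'I_m, (i < j)%N -> (x i < x j)%O.

Definition TN_infty {R : realType} {d d' : Order.disp_t}
    {X : orderType d} {Y : orderType d'} (K : X -> Y -> R) : Prop :=
  forall (m : nat) (x : 'I_m -> X) (y : 'I_m -> Y), (1 <= m)%N ->
    strictly_increasing x -> strictly_increasing y ->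
    0 <= \det (\matrix_(i < m, j < m) K (x i) (y j)).

Definition STP_infty {R : realType} {d d' : Order.disp_t}
    {X : orderType d} {Y : orderType d'} (K : X -> Y -> R) : Prop :=
  forall (m : nat) (x : 'I_m -> X) (y : 'I_m -> Y), (1 <= m)%N ->
    strictly_increasing x -> strictly_increasing y ->
    0 < \det (\matrix_(i < m, j < m) K (x i) (y j)).

Definition toeplitz {R : realType} (a : int -> R) : int -> int -> R :=
  fun i j => a (i - j).

Definition PF_seq {R : realType} : set {ptws int -> R} :=
  [set a | TN_infty (toeplitz a)].

Definition TP_PF_seq {R : realType} : set {ptws int -> R} :=
  [set a | STP_infty (toeplitz a)].

(* [dense] only speaks of whole spaces, so [A] is regarded as a type and given
   the topology induced by [T].  ([subspace A] would not do: its underlying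
   type is [T], with the points outside [A] isolated.) *)
Definition dense_in {T : topologicalType} (D A : set T) : Prop :=
  D `<=` A /\
  @dense (initial_topology (set_val : set_type A -> T))
    ((set_val : set_type A -> T) @^-1` D).

(* Main.v *)
(* A TN Toeplitz kernel [a (i - j)] is smoothed by convolving [a] with
   the discrete Gaussian [q ^ (n ^ 2)], which is STP by the positivity of
   generalized Vandermonde determinants and tends to the unit mass at 0 as
   [q -> 0].  By Cauchy-Binet, a minor of the convolution on given rows is a sum
   of products of nonnegative minors, and is positive as soon as some minor of
   the kernel of [a] on the same rows is nonzero.  If all of them vanish, the
   rows are linearly dependent, i.e. [a] satisfies a linear recurrence with
   constant coefficients; log-concavity then forces [a n = c * r ^ n].  Such
   sequences (zero included) are instead approximated by
   [(c + e) * r ^ n * (1 - e) ^ (n ^ 2)]. *)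

Require Import Defs.
From HB Require Import structures.
From mathcomp Require Import all_boot all_order all_algebra all_fingroup.
From mathcomp Require Import all_classical all_reals all_analysis.
From mathcomp Require Import zify ring lra.

Import Order.TTheory GRing.Theory Num.Theory.
Import numFieldNormedType.Exports.

Local Open Scope classical_set_scope.
Local Open Scope ring_scope.

(** * Determinant identities and the Cauchy-Binet formula *)

(** Each row of [A *m B] is a combination of rows of [B]; by multilinearity, every choice [f] of one
    row of [B] for each row of [A] contributes a term. *)
Lemma det_mulmx_rect (R : comPzRingType) (m n : nat) (A : 'M[R]_(m, n)) (B : 'M[R]_(n, m)) :
  \det (A *m B) =
  \sum_(f : {ffun 'I_m -> 'I_n}) (\prod_i A i (f i)) * \det (rowsub f B).
Proof.
pose AB (s : 'S_m) i k := A i k * B k (s i).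
transitivity (\sum_(f : {ffun 'I_m -> 'I_n})
                \sum_(s : 'S_m) (-1) ^+ s * \prod_i AB s i (f i)).
  rewrite exchange_big; apply: eq_bigr => /= s _; rewrite -big_distrr /=.
  congr (_ * _); rewrite -(bigA_distr_bigA (AB s)) /=.
  by apply: eq_bigr => x _; rewrite mxE.
apply: eq_bigr => f _; rewrite big_distrr /=; apply: eq_bigr => s _.
rewrite big_split /= mulrCA; congr (_ * (_ * _)).
by apply: eq_bigr => i _; rewrite mxE.
Qed.

Lemma det_row_perm (R : comPzRingType) (m : nat) (s : 'S_m) (M : 'M[R]_m) :
  \det (row_perm s M) = (-1) ^+ s * \det M.
Proof. by rewrite row_permE det_mulmx det_perm. Qed.

Lemma det_col_perm (R : comPzRingType) (m : nat) (s : 'S_m) (M : 'M[R]_m) :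
  \det (col_perm s M) = (-1) ^+ s * \det M.
Proof. by rewrite -det_tr tr_col_perm det_row_perm det_tr. Qed.

(* Summing over all maps instead of increasing ones counts each minor [m`!]
   times, and spares one the enumeration of the subsets of columns. *)
Lemma Cauchy_Binet (R : comPzRingType) (m n : nat) (A : 'M[R]_(m, n)) (B : 'M[R]_(n, m)) :
  (m`!)%:R * \det (A *m B) =
  \sum_(f : {ffun 'I_m -> 'I_n}) \det (colsub f A) * \det (rowsub f B).
Proof.
pose F (f : {ffun 'I_m -> 'I_n}) := (\prod_i A i (f i)) * \det (rowsub f B).
(* Precomposing with [s] permutes the maps [f], so each [s] contributes the same sum. After
   exchanging the sums, the signs of the reordered rows of [B] assemble the minor of [A]. *)
transitivity (\sum_(s : 'S_m) \sum_(f : {ffun 'I_m -> 'I_n}) F [ffun i => f (s i)]).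
  have -> : (m`!)%:R = \sum_(s : 'S_m) (1 : R).
    by rewrite big_const iter_addr_0 card_Sn.
  rewrite big_distrl /=; apply: eq_bigr => s _.
  rewrite mul1r det_mulmx_rect.
  rewrite (reindex (fun f : {ffun 'I_m -> 'I_n} => [ffun i => f (s i)])) //=.
  exists (fun f : {ffun 'I_m -> 'I_n} => [ffun i => f ((s^-1)%g i)]) => f _;
    by apply/ffunP => i; rewrite !ffunE (permK, permKV).
rewrite exchange_big /=; apply: eq_bigr => f _.
rewrite [X in _ = X * _]/determinant big_distrl /=; apply: eq_bigr => s _; rewrite /F.
have -> : \det (rowsub [ffun i => f (s i)] B) = (-1) ^+ s * \det (rowsub f B).
  rewrite -det_row_perm; congr (\det _).
  by apply/matrixP => i j; rewrite !mxE ffunE.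
rewrite mulrCA mulrA; congr (_ * _ * _).
by apply: eq_bigr => i _; rewrite mxE ffunE.
Qed.

Lemma det_scale_rows_cols (R : comNzRingType) (m : nat) (u v : 'I_m -> R) (M : 'M[R]_m) :
  \det (\matrix_(i, j) (u i * M i j * v j)) =
  (\prod_i u i) * \det M * (\prod_i v i).
Proof.
pose D (w : 'I_m -> R) := diag_mx (\row_j w j).
have detD w : \det (D w) = \prod_i w i.
  by rewrite det_diag; apply: eq_bigr => i _; rewrite mxE.
rewrite -!detD -!det_mulmx; congr (\det _).
by apply/matrixP => i j; rewrite /D mul_mx_diag mul_diag_mx !mxE.
Qed.

Lemma sort_injection {d : Order.disp_t} {X : orderType d} (m : nat) (f : 'I_m -> X) :
  injective f ->
  exists s : 'S_m, strictly_increasing (fun i => f (s i)).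
Proof.
move=> finj; pose t := [tuple f i | i < m].
have [s sE] := tuple_permP (introT permPl (perm_sort <=%O t)).
exists s => i j ij.
have /(lt_sorted_ltn_nth (f i)) : sorted <%O (sort <=%O t).
  by rewrite sort_lt_sorted map_inj_uniq ?enum_uniq.
have szs : size (sort <=%O t) = m by rewrite size_sort size_tuple.
move=> /(_ i j); rewrite !inE szs !ltn_ord ij => /(_ isT isT).
have nthE (k : 'I_m) : nth (f i) (sort <=%O t) k = f (s k).
  rewrite [in LHS]sE (nth_map k) ?size_enum_ord//.
  by rewrite nth_ord_enum tnth_mktuple.
by rewrite !nthE.
Qed.

(* The coefficients are cofactors: expand along a variable column. *)
Lemma minors0_dependent {R : fieldType} (T : Type) (m : nat) (F : 'I_m -> T -> R) :
  (forall t : 'I_m -> T, \det (\matrix_(i, j) F i (t j)) = 0) ->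
  exists2 c : 'I_m -> R, (exists i, c i != 0) &
    forall t, \sum_i c i * F i t = 0.
Proof.
elim: m F => [|m IH] F F0.
  have := F0 (fun i => match notF (ltn_ord i) with end).
  by rewrite det_mx00 => /eqP; rewrite oner_eq0.
pose F' i t := F (lift ord0 i) t.
have [F'0|] := pselect (forall t, \det (\matrix_(i, j) F' i (t j)) = 0).
  have [c [i0 ci0] cF] := IH F' F'0.
  exists (fun i => if unlift ord0 i is Some j then c j else 0).
    by exists (lift ord0 i0); rewrite liftK.
  move=> t; rewrite big_ord_recl unlift_none mul0r add0r -[RHS](cF t).
  by apply: eq_bigr => i _; rewrite liftK.
move=> /existsNP[t' /eqP t'0].
(* The minor of [F'] at [t'] is the cofactor of row 0, so the coefficients are not all zero. *)
pose M t := \matrix_(i, j) F i (if unlift ord0 j is Some k then t' k else t).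
have cofE t s i : cofactor (M t) i 0 = cofactor (M s) i 0.
  rewrite /cofactor; congr (_ * \det _).
  by apply/matrixP => a b; rewrite !mxE liftK.
have [[t0 _]|T0] := pselect (exists t : T, True); last first.
  exists (fun=> 1); first by exists ord0; rewrite oner_eq0.
  by move=> t; exfalso; apply: T0; exists t.
exists (fun i => cofactor (M t0) i 0).
  exists ord0; rewrite /cofactor expr0 mul1r; move: t'0; congr (\det _ != 0).
  by apply/matrixP => a b; rewrite !mxE liftK.
move=> t; rewrite -[RHS](F0 (fun j => if unlift ord0 j is Some k then t' k else t)).
rewrite (expand_det_col _ 0); apply: eq_bigr => i _.
by rewrite mulrC mxE unlift_none (cofE t0 t).
Qed.

(** [M] factors as the unitriangular matrix [L] of partial sums times the matrix [D] of row
    differences, whose column 0 is zero below its first entry 1. *)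
Lemma det_row_differences (R : comNzRingType) (m : nat) (M : 'M[R]_m.+1) :
  (forall i, M i 0 = 1) ->
  \det M = \det (\matrix_(i < m, j < m)
     (M (lift ord0 i) (lift ord0 j) - M (widen_ord (leqnSn m) i) (lift ord0 j))).
Proof.
move=> M1.
pose D : 'M[R]_m.+1 := \matrix_(i, j)
  (if unlift ord0 i is Some k then M i j - M (widen_ord (leqnSn m) k) j else M 0 j).
pose L : 'M[R]_m.+1 := \matrix_(i, j) ((j <= i)%N)%:R.
have LD : M = L *m D.
  apply/matrixP => i j; rewrite mxE.
  rewrite (eq_bigr (fun k : 'I_m.+1 => if (k <= i)%N then D k j else 0)); last first.
    by move=> k _; rewrite mxE; case: leqP; rewrite (mul1r, mul0r).
  rewrite -big_mkcond /=.
  pose g k := M (inord k) j - (if k is k'.+1 then M (inord k') j else 0).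
  rewrite (eq_bigr (fun k : 'I_m.+1 => g k)); last first.
    move=> k _; rewrite mxE; case: unliftP => [k' ->|->].
      rewrite /g /= /bump leq0n add1n.
      congr (M _ _ - M _ _); apply/val_inj; rewrite /= inordK ?ltnS //.
      by rewrite add0n ltnW // (ltn_ord k').
    rewrite /g subr0; congr (M _ _); apply: val_inj; rewrite /= inordK//.
  rewrite -(big_ord_widen _ g (ltn_ord i)).
  have -> : forall n, \sum_(k < n.+1) g k = M (inord n) j.
    elim=> [|n IH]; first by rewrite big_ord_recr big_ord0 /g /= subr0 add0r.
    by rewrite big_ord_recr /= IH /g /= addrC subrK.
  by rewrite inord_val.
rewrite [in LHS]LD det_mulmx (det_trig (A := L)); last first.
  by apply/is_trig_mxP => i j ij; rewrite mxE leqNgt ij.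
rewrite big1 ?mul1r; last by move=> i _; rewrite mxE leqnn.
rewrite (expand_det_col D 0) big_ord_recl big1 => [|i _]; last first.
  by rewrite mxE liftK !M1 subrr mul0r.
rewrite mxE unlift_none M1 mul1r addr0 /cofactor expr0 mul1r; congr (\det _).
by apply/matrixP => i j; rewrite !mxE liftK.
Qed.

(** * Positivity of generalized Vandermonde determinants *)

(** The range [k < n] does not depend on [p] and [q], so that sums over different gaps become
    entries of a single matrix product. *)
Lemma sum_telescope_window {R : zmodType} (F : nat -> R) (p q n : nat) :
  (p <= q <= n)%N ->
  \sum_(k < n | (p <= k < q)%N) (F k.+1 - F k) = F q - F p.
Proof.
move=> /andP[pq qn]; rewrite -telescope_sumr//.
by rewrite [RHS]big_geq_mkord
  -(big_ord_widen_cond n (fun k => p <= k)%N (fun k => F k.+1 - F k)).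
Qed.

(* After dividing row [i] by [s ^+ (x i * y ord0)], one may take [y ord0 = 0];
   the differences of consecutive rows are then telescoping sums of
   [s ^+ (k * y j) * (s ^+ y j - 1)] over the gaps [x i <= k < x i.+1], and
   expanding them by multilinearity gives a positive combination of
   determinants of the same shape and smaller size. *)
Lemma generalized_Vandermonde_gt0 {R : realFieldType} (s : R) (m : nat) (x y : 'I_m -> nat) :
  1 < s -> strictly_increasing x -> strictly_increasing y ->
  0 < \det (\matrix_(i, j) s ^+ (x i * y j)).
Proof.
move=> s1; have s0 : 0 < s by exact: lt_trans s1.
elim: m x y => [|m IH] x y xinc yinc; first by rewrite det_mx00.
have y0 j : (y ord0 <= y j)%N.
  have [->//|] := eqVneq j ord0; rewrite -lt0n => j0.
  by apply: ltnW; exact: (yinc ord0 j).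
rewrite (_ : \matrix_(i, j) _ = \matrix_(i, j) ((s ^+ (x i * y ord0)) *
    (\matrix_(i, j) s ^+ (x i * (y j - y ord0))) i j * 1)); last first.
  apply/matrixP => i j; rewrite !mxE mulr1 -exprD -mulnDr subnKC//.
rewrite det_scale_rows_cols [X in _ * X]big1 // mulr1 mulr_gt0 //.
  by apply: prodr_gt0 => i _; exact: exprn_gt0.
rewrite det_row_differences; last by move=> i; rewrite mxE subnn muln0 expr0.
pose z (j : 'I_m) := (y (lift ord0 j) - y ord0)%N.
have z0 j : (0 < z j)%N by rewrite subn_gt0; exact: yinc.
pose lo (i : 'I_m) := x (widen_ord (leqnSn m) i).
pose hi (i : 'I_m) := x (lift ord0 i).
pose n := x ord_max.
have lohi i : (lo i < hi i)%N by apply: xinc; rewrite /= /bump.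
have hin i : (hi i <= n)%N.
  rewrite /hi /n; have [->//|ne] := eqVneq (lift ord0 i) ord_max.
  by apply/ltnW/xinc; rewrite ltn_neqAle -ltnS ltn_ord andbT.
pose A : 'M[R]_(m, n) := \matrix_(i, k) ((lo i <= k < hi i)%N)%:R.
pose V : 'M[R]_(n, m) := \matrix_(k, j) s ^+ (k * z j).
rewrite (_ : \matrix_(i, j) _ = \matrix_(i, j) (1 * (A *m V) i j * (s ^+ z j - 1))); last first.
  apply/matrixP => i j; rewrite !mxE mul1r big_distrl /=.
  rewrite -/(z j) -/(lo i) -/(hi i).
  rewrite -(sum_telescope_window (fun k => s ^+ (k * z j)) _ _ n); last first.
    by rewrite (ltnW (lohi i)) hin.
  rewrite big_mkcond /=; apply: eq_bigr => k _; rewrite !mxE.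
  by case: ifP => _; rewrite ?mul0r// mul1r mulSn exprD mulrBr mulr1 mulrC.
rewrite det_scale_rows_cols big1 // mul1r mulr_gt0 //; last first.
  by apply: prodr_gt0 => j _; rewrite subr_gt0 exprn_egt1// -lt0n.
have lon i : (lo i < n)%N by exact: leq_trans (lohi i) (hin i).
(* A map choosing one point in each gap is strictly increasing, because [hi i <= lo j] whenever
   [i < j]; the induction hypothesis then applies. *)
have pos (f : {ffun 'I_m -> 'I_n}) : (forall i, lo i <= f i < hi i)%N ->
    0 < \det (rowsub f V).
  move=> fP; rewrite (_ : rowsub f V = \matrix_(i, j) s ^+ (f i * z j)); last first.
    by apply/matrixP => i j; rewrite !mxE.
  apply: IH => i j ij; last by rewrite ltEnat /= ltn_sub2rE ?y0 //; exact: yinc.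
  have /andP[_ h1] := fP i; have /andP[h2 _] := fP j.
  apply: (leq_trans h1); apply: leq_trans h2; rewrite /hi /lo.
  have [<-//|ne] := eqVneq (lift ord0 i) (widen_ord (leqnSn m) j).
  by apply/ltnW/xinc; rewrite ltn_neqAle ne /= /bump.
have ge0 (f : {ffun 'I_m -> 'I_n}) : 0 <= (\prod_i A i (f i)) * \det (rowsub f V).
  have [fP|] := boolP [forall i, (lo i <= f i < hi i)%N].
    apply: mulr_ge0; first by apply: prodr_ge0 => i _; rewrite mxE.
    by apply/ltW/pos => i; exact: (forallP fP).
  rewrite negb_forall => /existsP[i /negbTE fi].
  by rewrite (bigD1 i)//= mxE fi !mul0r.
(* The left endpoints of the gaps provide one positive term. *)
rewrite det_mulmx_rect (bigD1 [ffun i => Ordinal (lon i)])//=.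
apply: ltr_wpDr; first by apply: sumr_ge0 => f _; exact: ge0.
rewrite big1 => [|i _]; last by rewrite mxE ffunE /= leqnn lohi.
by rewrite mul1r; apply: pos => i; rewrite ffunE /= leqnn lohi.
Qed.

(** * Strictly totally positive kernels and the discrete Gaussian *)

Lemma STP_TN {R : realType} {d d' : Order.disp_t} {X : orderType d}
    {Y : orderType d'} (K : X -> Y -> R) : STP_infty K -> TN_infty K.
Proof. by move=> SK m x y m1 xi yi; apply/ltW/SK. Qed.

Lemma STP_scale {R : realType} {d d' : Order.disp_t} {X : orderType d}
    {Y : orderType d'} (K : X -> Y -> R) (u : X -> R) (v : Y -> R) :
  (forall x, 0 < u x) -> (forall y, 0 < v y) -> STP_infty K ->
  STP_infty (fun x y => u x * K x y * v y).
Proof.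
move=> u0 v0 SK m x y m1 xi yi.
rewrite (_ : \matrix_(i, j) _ = \matrix_(i, j) (u (x i) *
   (\matrix_(i, j) K (x i) (y j)) i j * v (y j))); last first.
  by apply/matrixP => i j; rewrite !mxE.
rewrite (det_scale_rows_cols _ _ (u \o x) (v \o y)).
by rewrite !mulr_gt0 ?prodr_gt0 ?SK // => i _; [exact: u0|exact: v0].
Qed.

Definition gauss {R : realType} (q : R) (n : int) : R := q ^+ (`|n| ^ 2)%N.

Lemma gauss_gt0 {R : realType} (q : R) (n : int) : 0 < q -> 0 < gauss q n.
Proof. exact: exprn_gt0. Qed.

Lemma strictly_increasing_ge {d : Order.disp_t} {X : porderType d} (m : nat)
    (x : 'I_m.+1 -> X) (i : 'I_m.+1) : strictly_increasing x -> (x ord0 <= x i)%O.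
Proof.
move=> xi; have [->//|] := eqVneq i ord0; rewrite -lt0n => i0.
exact/ltW/(xi ord0 i).
Qed.

(** Expanding [(x - y) ^ 2] factors the kernel as [q ^ (x ^ 2) * s ^ (x * y) * q ^ (y ^ 2)] with
    [s = q ^ (-2) > 1], a Vandermonde kernel with rescaled rows and columns. *)
Lemma gauss_STP {R : realType} (q : R) : 0 < q -> q < 1 ->
  STP_infty (toeplitz (gauss q)).
Proof.
move=> q0 q1 [//|m] x y _ xi yi.
(* Translating all nodes by [L] keeps their differences and makes them natural numbers. *)
pose L := Order.min (x ord0) (y ord0).
pose X i := `|x i - L|%N; pose Y i := `|y i - L|%N.
have XE i : x i - L = X i.
  by rewrite /X gez0_abs// subr_ge0 ge_min (strictly_increasing_ge _ _ _ xi).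
have YE i : y i - L = Y i.
  by rewrite /Y gez0_abs// subr_ge0 ge_min (strictly_increasing_ge _ _ _ yi) orbT.
pose s : R := (q ^+ 2)^-1.
have s1 : 1 < s by rewrite invf_gt1 ?exprn_gt0// exprn_ilt1// ltW.
have qs : q ^+ 2 * s = 1 by rewrite mulfV// expf_neq0// gt_eqF.
rewrite (_ : \matrix_(i, j) _ = \matrix_(i, j) (q ^+ (X i ^ 2)%N *
   (\matrix_(i, j) s ^+ (X i * Y j)%N) i j * q ^+ (Y j ^ 2)%N)); last first.
  apply/matrixP => i j; rewrite !mxE /toeplitz /gauss.
  have -> : x i - y j = (X i)%:Z - (Y j)%:Z by rewrite -XE -YE; ring.
  rewrite mulrAC -exprD -(sqrn_dist (X i) (Y j)) exprD -mulrA exprM -exprMn qs.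
  by rewrite expr1n mulr1.
rewrite det_scale_rows_cols !mulr_gt0 ?prodr_gt0//; try by move=> *; exact: exprn_gt0.
by apply: generalized_Vandermonde_gt0 => // i j ij; [have := xi _ _ ij|have := yi _ _ ij];
  rewrite /X /Y; move: (XE i) (XE j) (YE i) (YE j); lia.
Qed.

(** * Minors of order one and two *)

Lemma TN_ge0 {R : realType} (a : int -> R) (n : int) :
  TN_infty (toeplitz a) -> 0 <= a n.
Proof.
move=> Ta; have := Ta 1%N (fun=> n) (fun=> 0) isT.
rewrite det_mx11 mxE /toeplitz subr0; apply => i j; rewrite !ord1//.
Qed.

Lemma det_mx22 (R : comPzRingType) (M : 'M[R]_2) :
  \det M = M 0 0 * M 1 1 - M 0 1 * M 1 0.
Proof.
rewrite (expand_det_row _ 0) !big_ord_recl big_ord0 /cofactor !det_mx11 !mxE.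
rewrite /= addr0 expr0 expr1 mul1r mulN1r mulrN.
by congr (_ * M _ _ - M _ _ * M _ _); apply: val_inj.
Qed.

(** Log-concavity in a form without quotients, valid across zeros of [a]: the minor on rows [n + s],
    [n + s + t] and columns [0], [s]. *)
Lemma TN_minor2 {R : realType} (a : int -> R) (n : int) (s t : nat) :
  TN_infty (toeplitz a) -> a n * a (n + s%:Z + t%:Z) <= a (n + s%:Z) * a (n + t%:Z).
Proof.
move=> Ta.
have [->|s0] := posnP s; first by rewrite addr0.
have [->|t0] := posnP t; first by rewrite !addr0 mulrC.
pose x (i : 'I_2) : int := if i == 0 then n + s%:Z else n + s%:Z + t%:Z.
pose y (i : 'I_2) : int := if i == 0 then 0 else s%:Z.
have := Ta 2%N x y isT; rewrite det_mx22 !mxE /toeplitz /x /y /=.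
have -> : n + s%:Z + t%:Z - s%:Z = n + t%:Z by ring.
have -> : n + s%:Z - s%:Z = n by ring.
rewrite !subr0 subr_ge0; apply.
- case=> [[|[|//]] ?] [[|[|//]] ?] //=; rewrite /x /y /=; lia.
- case=> [[|[|//]] ?] [[|[|//]] ?] //=; rewrite /x /y /=; lia.
Qed.

(** * Two-sided series as limits of window sums *)

(** The window is the half-open interval from [-N] to [N - 1], whose points serve as the inner index
    of a matrix product. *)
Definition window_sum {R : realType} (f : int -> R) (N : nat) : R :=
  \sum_(k < N.*2) f (k%:Z - N%:Z).

Lemma window_sumS {R : realType} (f : int -> R) (N : nat) :
  window_sum f N.+1 = window_sum f N + (f N%:Z + f (- N.+1%:Z)).
Proof.
rewrite /window_sum doubleS big_ord_recl big_ord_recr /=.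
rewrite sub0r addrCA [f (- _) + _]addrC; congr (_ + (_ + _)).
  apply: eq_bigr => i _; congr f; rewrite /bump /=; lia.
congr f; rewrite /bump /=; lia.
Qed.

(** The two end terms are nonnegative and add up to the increment of a convergent sequence. *)
Lemma window_sum_cvg_ends {R : realType} (f : int -> R) (l : R) :
  (forall n, 0 <= f n) -> window_sum f @ \oo --> l ->
  f N%:Z @[N --> \oo] --> (0 : R) /\ f (- N.+1%:Z) @[N --> \oo] --> (0 : R).
Proof.
move=> f0 fl.
have d0 : window_sum f N.+1 - window_sum f N @[N --> \oo] --> (0 : R).
  by rewrite -(subrr l); apply: cvgB => //; rewrite cvg_shiftS.
have dE N : window_sum f N.+1 - window_sum f N = f N%:Z + f (- N.+1%:Z).
  by rewrite window_sumS addrAC subrr add0r.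
have h0 : (fun=> 0 : R) @ \oo --> (0 : R) by exact: cvg_cst.
by split; apply: (squeeze_cvgr _ h0 d0); apply: nearW => N; rewrite dE f0 /=;
  rewrite (lerDl, lerDr) f0.
Qed.

(** A unit shift only trades the term at [-N] for the one at [N], and both tend to 0. *)
Lemma window_sum_shift1 {R : realType} (f : int -> R) (l : R) :
  (forall n, 0 <= f n) -> window_sum f @ \oo --> l ->
  window_sum (fun n => f (n + 1)) @ \oo --> l.
Proof.
move=> f0 fl; have [fp fm] := window_sum_cvg_ends f l f0 fl.
have fm' : f (- N%:Z) @[N --> \oo] --> (0 : R) by rewrite -cvg_shiftS.
have -> : window_sum (fun n => f (n + 1)) =
    (fun N => window_sum f N + f N%:Z - f (- N%:Z)).
  apply/funext; elim=> [|N IH].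
    by rewrite /window_sum !big_ord0 add0r (_ : - 0%N%:Z = 0) ?subrr.
  rewrite window_sumS IH window_sumS.
  have -> : - N.+1%:Z + 1 = - N%:Z :> int by lia.
  have -> : N%:Z + 1 = N.+1%:Z :> int by lia.
  ring.
rewrite -[l]addr0 -[l + 0]subr0; apply: cvgB => //; exact: cvgD.
Qed.

(** Reflecting the half-open window amounts to a unit shift. *)
Lemma window_sum_opp {R : realType} (f : int -> R) (l : R) :
  (forall n, 0 <= f n) -> window_sum f @ \oo --> l ->
  window_sum (fun n => f (- n)) @ \oo --> l.
Proof.
move=> f0 fl.
suff -> : window_sum (fun n => f (- n)) = window_sum (fun n => f (n + 1)).
  exact: window_sum_shift1.
apply/funext => N; rewrite /window_sum.
rewrite (reindex_inj rev_ord_inj)/=; apply: eq_bigr => i _; congr f.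
have := ltn_ord i; lia.
Qed.

(** Positive shifts iterate the unit shift; negative ones are conjugate to them under
    [n |-> - n]. *)
Lemma window_sum_shift {R : realType} (f : int -> R) (l : R) (j : int) :
  (forall n, 0 <= f n) -> window_sum f @ \oo --> l ->
  window_sum (fun n => f (n + j)) @ \oo --> l.
Proof.
move=> f0 fl.
have shiftn (n : nat) g : (forall k, 0 <= g k) -> window_sum g @ \oo --> l ->
    window_sum (fun k => g (k + n%:Z)) @ \oo --> l.
  move=> g0 gl; elim: n => [|n IH].
    by under [fun k => _]eq_fun do rewrite addr0.
  have -> : (fun k => g (k + n.+1%:Z)) = (fun k => g (k + 1 + n%:Z)).
    by apply/funext => k; congr g; lia.
  exact: (window_sum_shift1 (fun k => g (k + n%:Z)) l (fun k => g0 _) IH).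
have [jE|jE] : j = `|j|%N%:Z \/ j = - `|j|%N%:Z by lia.
  by rewrite jE; exact: shiftn.
have -> : (fun k => f (k + j)) = (fun k => f (- (- k + `|j|%N%:Z))).
  by apply/funext => k; congr f; lia.
have := shiftn `|j|%N (fun k => f (- k)) (fun k => f0 _) (window_sum_opp f l f0 fl).
exact/(window_sum_opp _ _ (fun k => f0 _)).
Qed.

(** The correction [- 4 * e ^+ N.+1] makes the bound inductive: with [E = e ^+ N.+1] it frees
    [4 * E - 4 * e * E], enough for the new terms, at most [E + e * E] (times [D]), since
    [e <= 1/2]. *)
Lemma window_sum_bounds {R : realType} (f : int -> R) (D e : R) :
  0 <= D -> 0 < e -> e <= 2^-1 -> (forall n, 0 <= f n) ->
  (forall n, n != 0 -> f n <= D * e ^+ `|n|) ->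
  forall N, f 0 <= window_sum f N.+1 <= f 0 + D * (6 * e - 4 * e ^+ N.+1).
Proof.
move=> D0 e0 e2 f0 fb; elim=> [|N /andP[IH1 IH2]].
  rewrite window_sumS /window_sum big_ord0 add0r lerDl f0 lerD2l /=.
  apply: le_trans (fb _ _) _ => //; rewrite ler_wpM2l//.
  by rewrite abszN /= !expr1; lra.
rewrite window_sumS addrA.
have h1 := fb N.+1%:Z isT; have h2 := fb (- N.+2%:Z) isT.
apply/andP; split; first by rewrite -addrA (le_trans IH1)// lerDl addr_ge0.
have eN : 0 <= e ^+ N.+1 by exact/exprn_ge0/ltW.
move: h1 h2; rewrite abszN !absz_nat (exprS e N.+1) => h1 h2.
have h3 : e * e ^+ N.+1 <= 2^-1 * e ^+ N.+1 by exact: ler_wpM2r.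
have h5 : 0 <= D * e ^+ N.+1 by exact: mulr_ge0.
have h4 : D * (e * e ^+ N.+1) <= D * (2^-1 * e ^+ N.+1) by exact: ler_wpM2l.
move: h5 h4 IH2 h1 h2; set E := e ^+ N.+1; set W := window_sum _ _ => h5 h4 IH2 h1 h2.
lra.
Qed.

Lemma window_sum_cvg {R : realType} (f : int -> R) (D e : R) :
  0 <= D -> 0 < e -> e <= 2^-1 -> (forall n, 0 <= f n) ->
  (forall n, n != 0 -> f n <= D * e ^+ `|n|) ->
  exists2 l, window_sum f @ \oo --> l & f 0 <= l <= f 0 + 6 * D * e.
Proof.
move=> D0 e0 e2 f0 fb.
have B := window_sum_bounds f D e D0 e0 e2 f0 fb.
have B' N : f 0 <= window_sum f N.+1 <= f 0 + 6 * D * e.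
  have /andP[-> h] := B N; apply: (le_trans h); rewrite lerD2l.
  have : 0 <= D * e ^+ N.+1 by rewrite mulr_ge0// exprn_ge0// ltW.
  nra.
have cv : cvgn (window_sum f \o S).
  apply: nondecreasing_is_cvgn.
    apply/nondecreasing_seqP => N /=.
    by rewrite [leRHS]window_sumS lerDl addr_ge0.
  by exists (f 0 + 6 * D * e) => _ [N _ <-] /=; have /andP[] := B' N.
exists (limn (window_sum f \o S)); first by rewrite -cvg_shiftS; exact: cv.
apply/andP; split.
  by apply: limr_ge => //; apply: nearW => N /=; have /andP[] := B' N.
by apply: limr_le => //; apply: nearW => N /=; have /andP[] := B' N.
Qed.

(** * Strict total positivity of convolutions *)

(* Sorting [z] multiplies both determinants by the same sign. *)
Lemma TN_minors_mul_ge0 {R : realType} {d d' d'' : Order.disp_t}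
    {X : orderType d} {Y : orderType d'} {Z : orderType d''}
    (K : X -> Z -> R) (H : Z -> Y -> R) (m : nat)
    (x : 'I_m -> X) (y : 'I_m -> Y) (z : 'I_m -> Z) :
  TN_infty K -> TN_infty H -> (0 < m)%N ->
  strictly_increasing x -> strictly_increasing y ->
  0 <= \det (\matrix_(i < m, j < m) K (x i) (z j)) *
       \det (\matrix_(i < m, j < m) H (z i) (y j)).
Proof.
move=> TK TH m0 xi yi.
have [zinj|] := pselect (injective z); last first.
  move=> /existsNP[i /existsNP[j /not_implyP[zij /eqP ij]]].
  rewrite [X in X * _](_ : _ = 0) ?mul0r// -det_tr.
  by apply: (determinant_alternate ij) => k; rewrite !mxE zij.
have [s zs] := sort_injection _ _ zinj.
set M := \matrix_(i, j) K _ _; set M' := \matrix_(i, j) H _ _.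
have -> : \det M * \det M' = \det (col_perm s M) * \det (row_perm s M').
  by rewrite det_col_perm det_row_perm mulrACA -signr_addb addbb mul1r.
apply: mulr_ge0.
  have := TK m x _ m0 xi zs; congr (_ <= \det _).
  by apply/matrixP => i j; rewrite !mxE.
have := TH m _ y m0 zs yi; congr (_ <= \det _).
by apply/matrixP => i j; rewrite !mxE.
Qed.

Lemma cvg_det {R : realType} (m : nat) (M : nat -> 'M[R]_m) (L : 'M[R]_m) :
  (forall i j, M N i j @[N --> \oo] --> L i j) -> \det (M N) @[N --> \oo] --> \det L.
Proof.
move=> ML; apply: cvg_big => [|s _]; first exact: add_continuous.
apply: cvgM; first exact: cvg_cst.
by apply: cvg_big => [|i _]; [exact: mul_continuous|exact: ML].
Qed.

(** The truncated minors, times [m!], are eventually at least the fixed number [d > 0], which is one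
    term of their Cauchy-Binet sum; a uniform lower bound keeps strict positivity in the limit. *)
Lemma convolution_STP {R : realType} (a g b : int -> R) :
  TN_infty (toeplitz a) -> STP_infty (toeplitz g) ->
  (forall n, window_sum (fun k => a (n - k) * g k) @ \oo --> b n) ->
  (forall (m : nat) (x : 'I_m -> int), strictly_increasing x ->
    exists2 z : 'I_m -> int, strictly_increasing z &
      \det (\matrix_(i < m, j < m) a (x i - z j)) != 0) ->
  STP_infty (toeplitz b).
Proof.
move=> Ta Sg gb arank m x y m0 xi yi.
have Tg := STP_TN _ Sg.
have [z zi az] := arank m x xi.
pose w N (k : 'I_(N.*2)) := k%:Z - N%:Z.
pose A N := \matrix_(i < m, k < N.*2) a (x i - w N k).
pose G N := \matrix_(k < N.*2, j < m) g (w N k - y j).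
pose d := \det (\matrix_(i < m, j < m) toeplitz a (x i) (z j)) *
          \det (\matrix_(i < m, j < m) toeplitz g (z i) (y j)).
have d0 : 0 < d by rewrite mulr_gt0 ?Sg// lt_neqAle eq_sym az Ta.
set L := \matrix_(i, j) toeplitz b _ _.
(* Each entry is a window sum for [b (x i - y j)] with its index shifted by [y j], which does not
   affect the limit. *)
have cv : \det (A N *m G N) @[N --> \oo] --> \det L.
  apply: cvg_det => i j; rewrite [X in _ --> X]mxE.
  pose h n := a (x i - y j - n) * g n.
  have -> : (fun N => (A N *m G N) i j) = window_sum (fun n => h (n - y j)).
    apply/funext => N; rewrite mxE; apply: eq_bigr => k _; rewrite !mxE /h /w.
    by congr (a _ * _); ring.
  apply: window_sum_shift (gb _) => n.
  by rewrite mulr_ge0 ?(TN_ge0 a)// (TN_ge0 g).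
have m1 : 0 < (m`!)%:R :> R by rewrite ltr0n fact_gt0.
rewrite -(pmulr_rgt0 _ m1); apply: (lt_le_trans d0).
have cv' : (m`!)%:R * \det (A N *m G N) @[N --> \oo] --> (m`!)%:R * \det L.
  by apply: cvgM => //; exact: cvg_cst.
rewrite -(cvg_lim _ cv')//; apply: limr_ge; first by apply/cvg_ex; eexists; exact: cv'.
(* Beyond [N0] the window contains every [z i]. *)
pose N0 := (\sum_i `|z i|).+1.
exists N0 => // N /= N0N.
have zlt i : (`|z i| < N)%N.
  by apply: leq_trans N0N; rewrite ltnS (bigD1 i)//= leq_addr.
have wlt i : (`|(z i + N%:Z)%R| < N.*2)%N by have := zlt i; lia.
pose f := [ffun i => Ordinal (wlt i)].
have wf i : w N (f i) = z i by rewrite /w ffunE /=; have := zlt i; lia.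
rewrite Cauchy_Binet (bigD1 f)//=.
have <- : \det (colsub f (A N)) * \det (rowsub f (G N)) = d.
  by rewrite /d; apply: f_equal2; congr (\det _); apply/matrixP => i j; rewrite !mxE wf.
rewrite lerDl; apply: sumr_ge0 => h _.
rewrite (_ : colsub h (A N) = \matrix_(i, j) toeplitz a (x i) (w N (h j))); last first.
  by apply/matrixP => i j; rewrite !mxE.
rewrite (_ : rowsub h (G N) = \matrix_(i, j) toeplitz g (w N (h i)) (y j)); last first.
  by apply/matrixP => i j; rewrite !mxE.
exact: TN_minors_mul_ge0.
Qed.

(** * Linear recurrences satisfied by Pólya-frequency sequences *)

(** This is [P(E) a] for the forward shift [E]; a recurrence with constant coefficients reads
    [P(E) a = 0], and factoring [P] factors the operator. *)
Definition shift_poly {R : realType} (P : {poly R}) (a : int -> R) (n : int) : R :=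
  \sum_(j < size P) P`_j * a (n + j%:Z).

Lemma shift_poly_widen {R : realType} (d : nat) (P : {poly R}) (a : int -> R) (n : int) :
  (size P <= d)%N -> shift_poly P a n = \sum_(j < d) P`_j * a (n + j%:Z).
Proof.
move=> Pd; rewrite /shift_poly (big_ord_widen d (fun j => P`_j * a (n + j%:Z)) Pd).
rewrite [LHS]big_mkcond /=; apply: eq_bigr => j _.
by case: ltnP => // Pj; rewrite nth_default// mul0r.
Qed.

Lemma shift_poly_mulXsubC {R : realType} (Q : {poly R}) (r : R) (a : int -> R) (n : int) :
  shift_poly (Q * ('X - r%:P)) a n = shift_poly Q a (n + 1) - r * shift_poly Q a n.
Proof.
have sQ : (size (Q * ('X - r%:P))%R <= (size Q).+1)%N.
  by apply: (leq_trans (size_polyMleq _ _)); rewrite size_XsubC addn2.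
rewrite (shift_poly_widen (size Q).+1)//.
rewrite [X in r * X](shift_poly_widen (size Q).+1)//.
have -> : shift_poly Q a (n + 1) =
    \sum_(j < (size Q).+1) (if (j == 0 :> nat)%N then 0 else Q`_j.-1) * a (n + j%:Z).
  rewrite big_ord_recl /= mul0r add0r; apply: eq_bigr => j _ /=.
  by congr (_ * a _); rewrite /bump; lia.
rewrite mulr_sumr -sumrB; apply: eq_bigr => j _.
rewrite mulrBr coefB coefMX coefMC; case: ifP => _; ring.
Qed.

Lemma cst_cvg_eq {R : realType} (c l : R) : (fun=> c : R) @ \oo --> l -> c = l.
Proof. by move=> cl; rewrite -(cvg_lim _ cl)// lim_cst. Qed.

(** Dividing the recurrence at [s + k] by [a (s + k)] and letting [k] grow turns it into [P.[r] =
    0], as [a (s + k + j) / a (s + k)] tends to [r ^+ j]. *)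
Lemma root_shift_poly {R : realType} (a : int -> R) (s : int) (r : R) (P : {poly R}) :
  (forall k : nat, 0 < a (s + k%:Z)) ->
  a (s + k.+1%:Z) / a (s + k%:Z) @[k --> \oo] --> r ->
  (forall n, shift_poly P a n = 0) -> root P r.
Proof.
move=> a0 ar Pa.
have arj (j : nat) : a (s + (k + j)%:Z) / a (s + k%:Z) @[k --> \oo] --> r ^+ j.
  elim: j => [|j IH].
    rewrite expr0; have -> : (fun k : nat => a (s + (k + 0)%:Z) / a (s + k%:Z)) = fun=> 1.
      by apply/funext => k; rewrite addn0 divff// gt_eqF.
    exact: cvg_cst.
  have -> : (fun k : nat => a (s + (k + j.+1)%:Z) / a (s + k%:Z)) =
      (fun k : nat => (a (s + (k + j).+1%:Z) / a (s + (k + j)%:Z)) *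
                (a (s + (k + j)%:Z) / a (s + k%:Z))).
    by apply/funext => k; rewrite mulrA divfK ?addnS// gt_eqF.
  rewrite exprS; apply: cvgM => //.
  by rewrite (cvg_shiftn j (fun k : nat => a (s + k.+1%:Z) / a (s + k%:Z))).
have h : \sum_(j < size P) P`_j * (a (s + (k + j)%:Z) / a (s + k%:Z)) @[k --> \oo]
    --> P.[r].
  rewrite horner_coef; apply: cvg_big => [|j _]; first exact: add_continuous.
  by apply: cvgM; [exact: cvg_cst|exact: arj].
have h0 : (fun k : nat => \sum_(j < size P) P`_j * (a (s + (k + j)%:Z) / a (s + k%:Z)))
    = fun=> 0.
  apply/funext => k; rewrite -[RHS](mul0r (a (s + k%:Z))^-1) -[in RHS](Pa (s + k%:Z)).
  rewrite mulr_suml; apply: eq_bigr => j _; rewrite mulrA; congr (_ * a _ * _); lia.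
by rewrite h0 in h; apply/rootP; rewrite (cst_cvg_eq _ _ h).
Qed.

(** For [m <= n0] the hypothesis iterates to [a (m - k) <= a m / s ^ k], whence the bound
    [a m * (r / s) ^ k]. Larger indices reduce to these, each unit step costing a factor [r]. *)
Lemma decay_at_minus_infinity {R : realType} (a : int -> R) (r s : R) (n0 n : int) :
  0 <= r -> r < s -> (forall n, 0 <= a n) ->
  (forall n, n <= n0 -> s * a n <= a (n + 1)) ->
  r ^+ k * a (n - k%:Z) @[k --> \oo] --> (0 : R).
Proof.
move=> r0 rs a0 sa.
have s0 : 0 < s by exact: le_lt_trans rs.
have low m : m <= n0 -> r ^+ k * a (m - k%:Z) @[k --> \oo] --> (0 : R).
  move=> mn0.
  have geo : geometric (a m) (r / s) @ \oo --> (0 : R).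
    by apply: cvg_geometric; rewrite ger0_norm ?divr_ge0// ?ltr_pdivrMr ?mul1r// ltW.
  apply: (squeeze_cvgr _ (cvg_cst (0 : R)) geo); apply: nearW => k /=.
  rewrite mulr_ge0 ?exprn_ge0//= exprMn mulrCA ler_wpM2l ?exprn_ge0//.
  rewrite exprVn ler_pdivlMr ?exprn_gt0//.
  elim: k => [|k IH]; first by rewrite expr0 mulr1 subr0.
  apply: le_trans IH; rewrite exprSr mulrCA mulrC; apply: ler_wpM2r.
    exact/exprn_ge0/ltW.
  rewrite mulrC; have -> : m - k%:Z = m - k.+1%:Z + 1 by lia.
  by apply: sa; lia.
have up (p : nat) m : m <= n0 + p%:Z -> r ^+ k * a (m - k%:Z) @[k --> \oo] --> (0 : R).
  elim: p m => [|p IH] m mp; first by apply: low; rewrite addr0 in mp.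
  rewrite -cvg_shiftS; have -> : (fun k : nat => r ^+ k.+1 * a (m - k.+1%:Z)) =
      (fun k : nat => r * (r ^+ k * a (m - 1 - k%:Z))).
    by apply/funext => k; rewrite exprS mulrA; congr (_ * a _); lia.
  have h : r * (r ^+ k * a (m - 1 - k%:Z)) @[k --> \oo] --> r * 0.
    by apply: cvgM; [exact: cvg_cst|apply: IH; lia].
  by rewrite mulr0 in h.
by apply: (up `|n - n0|%N); lia.
Qed.

(* [r] is a root of [P = Q * ('X - r%:P)], and [b = shift_poly Q a] satisfies
   [b (n + 1) = r * b n] while [r ^+ k * b (n - k)] tends to [0]; hence [b = 0]. *)
Lemma shift_poly_injective {R : realType} (a : int -> R) (s n0 : int) (r t : R) :
  (forall n, 0 <= a n) -> (forall k : nat, 0 < a (s + k%:Z)) ->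
  a (s + k.+1%:Z) / a (s + k%:Z) @[k --> \oo] --> r ->
  0 <= r -> r < t -> (forall n, n <= n0 -> t * a n <= a (n + 1)) ->
  forall P, (forall n, shift_poly P a n = 0) -> P = 0.
Proof.
move=> a0 apos ar r0 rt ta P; have [m] := ubnP (size P); elim: m P => // m IH P Pm Pa.
have /factor_theorem[Q PQ] := root_shift_poly _ _ _ _ apos ar Pa.
have [Q0|Q0] := eqVneq Q 0; first by rewrite PQ Q0 mul0r.
suff Qa n : shift_poly Q a n = 0.
  rewrite PQ (IH Q) ?mul0r//; rewrite -ltnS; apply: leq_trans Pm.
  by rewrite PQ size_Mmonic ?monicXsubC// size_XsubC addn2.
have step k : shift_poly Q a (k + 1) = r * shift_poly Q a k.
  by apply/eqP; rewrite -subr_eq0 -shift_poly_mulXsubC -PQ Pa.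
have bk (k : nat) : shift_poly Q a n = r ^+ k * shift_poly Q a (n - k%:Z).
  elim: k => [|k ->]; first by rewrite expr0 mul1r subr0.
  rewrite exprSr -mulrA -step; congr (_ * shift_poly _ _ _); lia.
have h : \sum_(j < size Q) Q`_j * (r ^+ k * a (n + j%:Z - k%:Z)) @[k --> \oo]
    --> \sum_(j < size Q) Q`_j * 0.
  apply: cvg_big => [|j _]; first exact: add_continuous.
  by apply: cvgM; [exact: cvg_cst|exact: decay_at_minus_infinity ta].
have h0 : (fun k : nat => \sum_(j < size Q) Q`_j * (r ^+ k * a (n + j%:Z - k%:Z)))
    = fun=> shift_poly Q a n.
  apply/funext => k; rewrite (bk k) mulr_sumr; apply: eq_bigr => j _.
  by rewrite mulrCA addrAC.
by rewrite h0 in h; rewrite (cst_cvg_eq _ _ h) big1// => j _; rewrite mulr0.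
Qed.

(** If [j] is the lowest index of a nonzero coefficient, the recurrence at [N - j] reduces to
    [P_j * a N = 0]. *)
Lemma shift_poly_bounded_above {R : realType} (a : int -> R) (N : int) (P : {poly R}) :
  0 < a N -> (forall n, N < n -> a n = 0) ->
  (forall n, shift_poly P a n = 0) -> P = 0.
Proof.
move=> aN aN0 Pa; have [//|P0] := eqVneq P 0; exfalso.
have exj : exists j, P`_j != 0.
  by exists (size P).-1; rewrite -lead_coefE lead_coef_eq0.
have [j Pj jmin] := ex_minnP exj.
have jP : (j < size P)%N by rewrite ltnNge; apply: contraNN Pj => h; rewrite nth_default.
have := Pa (N - j%:Z); rewrite /shift_poly (bigD1 (Ordinal jP))//= subrK.
rewrite big1 ?addr0 => [/eqP|i ij].
  by rewrite mulf_eq0 (negbTE Pj) gt_eqF.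
have [ji|ji] := ltnP j i; first by rewrite aN0 ?mulr0//; lia.
have [->|Pi] := eqVneq P`_i 0; first by rewrite mul0r.
have ij' : i = j :> nat by apply/eqP; rewrite eqn_leq ji jmin.
by move/eqP: ij; case; apply: val_inj.
Qed.

Lemma geometric_of_step {R : realType} (a : int -> R) (r : R) :
  0 < r -> (forall n, a (n + 1) = r * a n) -> forall n, a n = a 0 * r ^ n.
Proof.
move=> r0 ar n; have [nE|nE] : n = `|n|%N%:Z \/ n = - `|n|%N%:Z by lia.
  rewrite nE; elim: `|n|%N => [|k IH]; first by rewrite expr0z mulr1.
  have -> : k.+1%:Z = k%:Z + 1 by lia.
  by rewrite ar IH expfzDr ?gt_eqF// expr1z; ring.
rewrite nE; elim: `|n|%N => [|k IH]; first by rewrite expr0z mulr1.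
apply: (mulfI (lt0r_neq0 r0)); rewrite -ar.
have -> : - k.+1%:Z + 1 = - k%:Z by lia.
have -> : - k.+1%:Z = - k%:Z - 1 by lia.
rewrite IH expfzDr ?gt_eqF// exprN1; field; exact: lt0r_neq0.
Qed.

(* If [a (n0 + 1) > r * a n0] for some [n0], where [r] is the limit of the
   ratios at [+oo], log-concavity makes [a] decay faster than [r ^ n] at [-oo]
   and no recurrence can hold; otherwise all the ratios are equal to [r]. *)
Lemma PF_recurrence_geometric {R : realType} (a : int -> R) (P : {poly R}) :
  TN_infty (toeplitz a) -> P != 0 -> (forall n, shift_poly P a n = 0) ->
  exists c r : R, [/\ 0 <= c, 0 < r & forall n, a n = c * r ^ n].
Proof.
move=> Ta P0 Pa; have a0 n : 0 <= a n by exact: TN_ge0.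
have [aE|/existsNP[s /eqP as0]] := pselect (forall n, a n = 0).
  by exists 0, 1; split=> // n; rewrite mul0r.
have {}as0 : 0 < a s by rewrite lt_neqAle eq_sym as0 a0.
have [exk|apos] := pselect (exists k : nat, a (s + k%:Z) == 0).
  exfalso; move/eqP: P0; apply.
  have [[|k] /eqP ak kmin] := ex_minnP exk.
    by move: as0; rewrite -[s]addr0 ak ltxx.
  have ak1 : 0 < a (s + k%:Z).
    by rewrite lt_neqAle a0 andbT eq_sym; apply/negP => /kmin; rewrite ltnn.
  apply: (shift_poly_bounded_above _ _ _ ak1) => // n sn.
  (* Log-concavity propagates the first zero after [s] to all later indices. *)
  have := TN_minor2 a (s + k%:Z) 1 `|n - (s + k.+1%:Z)%R|%N Ta.
  have -> : s + k%:Z + 1%N%:Z = s + k.+1%:Z by lia.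
  have -> : s + k.+1%:Z + `|n - (s + k.+1%:Z)%R|%N%:Z = n by lia.
  rewrite ak mul0r pmulr_rle0// => an.
  by apply/eqP; rewrite eq_le an a0.
have {}apos (k : nat) : 0 < a (s + k%:Z).
  by rewrite lt_neqAle a0 andbT eq_sym; apply/negP => h; apply: apos; exists k.
pose rho (k : nat) := a (s + k.+1%:Z) / a (s + k%:Z).
have rho0 k : 0 <= rho k by rewrite divr_ge0.
have rhoD : nonincreasing_seq rho.
  apply/nonincreasing_seqP => k; rewrite /rho ler_pdivrMr// mulrAC ler_pdivlMr//.
  have := TN_minor2 a (s + k%:Z) 1 1 Ta.
  have -> : s + k%:Z + 1%N%:Z = s + k.+1%:Z by lia.
  have -> : s + k.+1%:Z + 1%N%:Z = s + k.+2%:Z by lia.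
  by rewrite mulrC.
have rhoB : has_lbound (range rho) by exists 0 => _ [k _ <-].
have rhoC := nonincreasing_is_cvgn rhoD rhoB.
pose r := limn rho.
have r0 : 0 <= r by apply: limr_ge => //; exact: nearW.
have rrho k : r <= rho k by exact: nonincreasing_cvgn_ge.
have [[n0 an0]|step] := pselect (exists n0, r * a n0 < a (n0 + 1)).
  exfalso; move/eqP: P0; apply.
  have an1 : 0 < a (n0 + 1) by apply: le_lt_trans an0; exact: mulr_ge0.
  (* The ratio at [n0] serves as [t]; if [a n0 = 0], any number above [r] does. *)
  have [t rt ta] : exists2 t, r < t & t * a n0 <= a (n0 + 1).
    have [an00|an00] := eqVneq (a n0) 0.
      by exists (r + 1); rewrite ?ltrDl// an00 mulr0.
    have {}an00 : 0 < a n0 by rewrite lt_neqAle eq_sym an00 a0.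
    by exists (a (n0 + 1) / a n0); rewrite ?ltr_pdivlMr// divfK// gt_eqF.
  apply: (shift_poly_injective a s n0 r t) => // n nn0.
  have := TN_minor2 a n 1 `|n0 - n|%N Ta.
  have -> : n + 1%N%:Z + `|n0 - n|%N%:Z = n0 + 1 by lia.
  have -> : n + `|n0 - n|%N%:Z = n0 by lia.
  move=> h; rewrite -(ler_pM2r an1) -mulrA; apply: (le_trans (y := t * (a (n + 1) * a n0))).
    by rewrite ler_wpM2l//; exact: (le_trans r0 (ltW rt)).
  by rewrite mulrCA ler_wpM2l.
have {}step n : a (n + 1) <= r * a n.
  by rewrite leNgt; apply/negP => h; apply: step; exists n.
have rpos : 0 < r.
  rewrite lt_neqAle r0 andbT; apply/eqP => rE.
  by have := step s; rewrite -rE mul0r leNgt (apos 1%N).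
have rs (k : nat) : r * a (s + k%:Z) <= a (s + k%:Z + 1).
  have := rrho k; rewrite /rho ler_pdivlMr//.
  by have -> : s + k.+1%:Z = s + k%:Z + 1 by lia.
exists (a 0), r; split=> //; apply: geometric_of_step => // n.
apply/eqP; rewrite eq_le step /=.
have [sn|ns] := leP s n.
  by have := rs `|n - s|%N; have -> : s + `|n - s|%N%:Z = n by lia.
(* To the left of [s], log-concavity bounds the ratio at [n] below by the ratio at [s], itself at
   least [r]. *)
have := TN_minor2 a n 1 `|s - n|%N Ta.
have -> : n + 1%N%:Z + `|s - n|%N%:Z = s + 1 by lia.
have -> : n + `|s - n|%N%:Z = s by lia.
move=> h; rewrite -(ler_pM2r as0); apply: le_trans h.
rewrite mulrAC mulrC ler_wpM2l//.
by have := rs 0%N; rewrite addr0.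
Qed.


(** If all minors on the rows [x] vanished, a dependence between these rows would be a recurrence
    for [a], with exponents [x i - x ord0], and [a] would be geometric. *)
Lemma PF_minor_neq0 {R : realType} (a : int -> R) (m : nat) (x : 'I_m -> int) :
  TN_infty (toeplitz a) ->
  ~ (exists c r : R, [/\ 0 <= c, 0 < r & forall n, a n = c * r ^ n]) ->
  strictly_increasing x ->
  exists2 z : 'I_m -> int, strictly_increasing z &
    \det (\matrix_(i < m, j < m) a (x i - z j)) != 0.
Proof.
move=> Ta ngeo xi.
have [[t t0]|t0] := pselect (exists t : 'I_m -> int,
    \det (\matrix_(i < m, j < m) a (x i - t j)) != 0).
  have tinj : injective t.
    move=> i j tij; apply/eqP; apply: contraNT t0 => ij.
    rewrite -det_tr; apply/eqP; apply: (determinant_alternate ij) => k.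
    by rewrite !mxE tij.
  have [s ts] := sort_injection _ _ tinj; exists (fun i => t (s i)) => //.
  rewrite (_ : \matrix_(i, j) _ = col_perm s (\matrix_(i, j) a (x i - t j))); last first.
    by apply/matrixP => i j; rewrite !mxE.
  by rewrite det_col_perm mulf_neq0// signr_eq0.
exfalso; apply: ngeo.
have {}t0 (t : 'I_m -> int) : \det (\matrix_(i < m, j < m) a (x i - t j)) = 0.
  by apply/eqP; apply/negPn/negP => h; apply: t0; exists t.
have [c [i0 ci0] cF] := minors0_dependent _ m (fun i t => a (x i - t)) t0.
case: m x xi t0 c i0 ci0 cF => [|m] x xi t0 c i0 ci0 cF; first by have := ltn_ord i0.
pose e i := `|x i - x ord0|%N.
have eE i : x i = x ord0 + e i.
  by have := strictly_increasing_ge _ _ i xi; rewrite /e; lia.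
have einj i j : e i = e j -> i = j.
  move=> ij; apply/val_inj; case: (ltngtP i j) => // /xi;
    by rewrite (eE i) (eE j) ij ltxx.
pose P : {poly R} := \sum_i c i *: 'X^(e i).
have PE k : P`_k = \sum_i c i * (k == e i)%:R.
  by rewrite coef_sum; apply: eq_bigr => i _; rewrite coefZ coefXn.
apply: (PF_recurrence_geometric a P) => //.
  apply/eqP => P0; move/eqP: ci0; apply; have := PE (e i0).
  rewrite P0 coef0 (bigD1 i0)//= eqxx mulr1 big1 ?addr0// => i ii0.
  by case: eqP => [/einj ij|_]; [rewrite ij eqxx in ii0|rewrite mulr0].
(* The bound [d] exceeds every exponent [e i] as well as the size of [P], so the sums can be
   exchanged over one range. *)
move=> n; pose d := maxn (size P) (\sum_i e i).+1.
rewrite (shift_poly_widen d) ?leq_maxl//.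
rewrite -[RHS](cF (x ord0 - n)).
under eq_bigr do rewrite PE mulr_suml.
rewrite exchange_big /=; apply: eq_bigr => i _.
have ed : (e i < d)%N by rewrite leq_max (bigD1 i)//= ltnS leq_addr orbT.
rewrite (bigD1 (Ordinal ed))//= eqxx mulr1 big1 ?addr0.
  by rewrite [in RHS]eE; congr (_ * a _); lia.
move=> j je; case: eqP => [ji|_]; last by rewrite mulr0 mul0r.
by move/eqP: je; case; apply: val_inj.
Qed.

(** * Growth bound and construction of the approximants *)

(** From a point [s] with [a s > 0], log-concavity bounds all later ratios in either direction by
    the first one. *)
Lemma PF_growth {R : realType} (a : int -> R) : TN_infty (toeplitz a) ->
  exists C M : R, [/\ 0 <= C, 1 <= M & forall n, a n <= C * M ^+ `|n|].
Proof.
move=> Ta; have a0 n : 0 <= a n by exact: TN_ge0.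
have [aE|/existsNP[s /eqP as0]] := pselect (forall n, a n = 0).
  by exists 0, 1; split=> // n; rewrite mul0r aE.
have {}as0 : 0 < a s by rewrite lt_neqAle eq_sym as0 a0.
pose M := Num.max 1 (Num.max (a (s + 1) / a s) (a (s - 1) / a s)).
have M1 : 1 <= M by rewrite le_max lexx.
have M0 : 0 <= M by exact: le_trans M1.
have Mp : a (s + 1) <= M * a s by rewrite -ler_pdivrMr// !le_max lexx orbT.
have Mm : a (s - 1) <= M * a s by rewrite -ler_pdivrMr// !le_max lexx !orbT.
have up (k : nat) : a (s + k%:Z) <= a s * M ^+ k.
  elim: k => [|k IH]; first by rewrite addr0 expr0 mulr1.
  have := TN_minor2 a s 1 k Ta.
  have -> : s + 1%N%:Z + k%:Z = s + k.+1%:Z by lia.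
  move=> h; rewrite -(ler_pM2l as0); apply: (le_trans h).
  apply: (le_trans (ler_pM (a0 _) (a0 _) Mp IH)).
  by rewrite exprS; lra.
have down (k : nat) : a (s - k%:Z) <= a s * M ^+ k.
  elim: k => [|k IH]; first by rewrite subr0 expr0 mulr1.
  have := TN_minor2 a (s - k.+1%:Z) k 1 Ta.
  have -> : s - k.+1%:Z + k%:Z + 1%N%:Z = s by lia.
  have -> : s - k.+1%:Z + k%:Z = s - 1 by lia.
  have -> : s - k.+1%:Z + 1%N%:Z = s - k%:Z by lia.
  move=> h; rewrite -(ler_pM2r as0); apply: (le_trans h).
  apply: (le_trans (ler_pM (a0 _) (a0 _) Mm IH)).
  by rewrite exprS; lra.
exists (a s * M ^+ `|s|), M; split=> [||n] //; first by rewrite mulr_ge0// exprn_ge0.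
have : a n <= a s * M ^+ `|n - s|.
  have [sn|ns] := leP s n.
    by have := up `|n - s|%N; have -> : s + `|n - s|%N%:Z = n by lia.
  by have := down `|n - s|%N; have -> : s - `|n - s|%N%:Z = n by lia.
move=> /le_trans; apply; rewrite -mulrA -exprD ler_wpM2l// ler_weXn2l//; lia.
Qed.

(** Since [r ^ (x - y) = r ^ x * r ^ (- y)], the approximants rescale rows and columns of a Gaussian
    kernel whose parameter tends to 1; adding [e k] to [c] covers [c = 0]. *)
Lemma geometric_approx {R : realType} (c r : R) : 0 <= c -> 0 < r ->
  exists b : nat -> int -> R, (forall k, STP_infty (toeplitz (b k))) /\
    (forall n, b k n @[k --> \oo] --> c * r ^ n).
Proof.
move=> c0 r0; pose e k : R := k.+2%:R^-1.
have e0 k : 0 < e k by rewrite invr_gt0.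
have e1 k : e k < 1 by rewrite invf_lt1// ltr1n.
have ecvg : e @ \oo --> (0 : R).
  by have := @cvg_harmonic R; rewrite -cvg_shiftS.
exists (fun k n => (c + e k) * r ^ n * gauss (1 - e k) n); split.
  move=> k; have q0 : 0 < 1 - e k by rewrite subr_gt0.
  have q1 : 1 - e k < 1 by rewrite ltrBlDr ltrDl.
  have -> : toeplitz (fun n : int => (c + e k) * r ^ n * gauss (1 - e k) n) =
      (fun x y : int => (c + e k) * r ^ x * toeplitz (gauss (1 - e k)) x y * r ^ (- y)).
    by apply/funext => x; apply/funext => y; rewrite /toeplitz expfzDr ?gt_eqF//; ring.
  apply: (STP_scale _ (fun x : int => (c + e k) * r ^ x) (fun y : int => r ^ (- y))).
  - by move=> x; rewrite mulr_gt0 ?exprz_gt0// ltr_wpDl.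
  - by move=> y; rewrite exprz_gt0.
  - exact: gauss_STP.
move=> n.
have h1 : c + e k @[k --> \oo] --> c + 0 by apply: cvgD => //; exact: cvg_cst.
have h2 : 1 - e k @[k --> \oo] --> (1 - 0 : R) by apply: cvgB => //; exact: cvg_cst.
have h3 (p : nat) : (1 - e k) ^+ p @[k --> \oo] --> (1 - 0 : R) ^+ p.
  elim: p => [|p IH]; first exact: cvg_cst.
  under eq_fun do rewrite exprS; rewrite exprS; exact: cvgM.
have h4 : (c + e k) * r ^ n * gauss (1 - e k) n @[k --> \oo] -->
    (c + 0) * r ^ n * (1 - 0) ^+ (`|n| ^ 2)%N.
  by apply: cvgM; [apply: cvgM; [exact: h1|exact: cvg_cst]|exact: h3].
by rewrite addr0 subr0 expr1n mulr1 in h4.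
Qed.

Lemma convolution_approx {R : realType} (a : int -> R) :
  TN_infty (toeplitz a) ->
  ~ (exists c r : R, [/\ 0 <= c, 0 < r & forall n, a n = c * r ^ n]) ->
  exists b : nat -> int -> R, (forall k, STP_infty (toeplitz (b k))) /\
    (forall n, b k n @[k --> \oo] --> a n).
Proof.
move=> Ta ngeo; have a0 n : 0 <= a n by exact: TN_ge0.
have [C [M [C0 M1 aM]]] := PF_growth a Ta.
have M0 : 0 < M by exact: lt_le_trans M1.
pose e k : R := k.+2%:R^-1.
have e0 k : 0 < e k by rewrite invr_gt0.
have e2 k : e k <= 2^-1 by rewrite lef_pV2 ?posrE// ler_nat.
have ecvg : e @ \oo --> (0 : R).
  by have := @cvg_harmonic R; rewrite -cvg_shiftS.
(* Dividing by [M] absorbs the growth of [a]: the terms of the convolution are then dominated by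
   powers of [e k]. *)
pose q k := e k / M.
have q0 k : 0 < q k by rewrite divr_gt0.
have q1 k : q k < 1.
  by rewrite ltr_pdivrMr// mul1r; have := e2 k; lra.
pose f k n i := a (n - i) * gauss (q k) i.
have f0 k n i : 0 <= f k n i by rewrite mulr_ge0// ltW// gauss_gt0.
pose D n := C * M ^+ `|n|.
have D0 n : 0 <= D n by rewrite mulr_ge0// exprn_ge0// ltW.
have fD k n i : f k n i <= D n * e k ^+ `|i|.
  have h1 : a (n - i) <= D n * M ^+ `|i|.
    apply: (le_trans (aM _)); rewrite /D -mulrA -exprD ler_wpM2l// ler_weXn2l//; lia.
  (* Here [q k < 1] and [|i| <= |i| ^ 2]. *)
  have h2 : gauss (q k) i <= q k ^+ `|i|.
    apply: ler_wiXn2l; rewrite ?ltW//.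
    by rewrite expnS expn1; case: `|i|%N => // p; rewrite leq_pmulr.
  apply: (le_trans (ler_pM _ _ h1 h2)) => //; first exact/ltW/gauss_gt0.
  by rewrite -mulrA -exprMn /q [M * _]mulrC divfK// gt_eqF.
have fb k n : exists2 l, window_sum (f k n) @ \oo --> l &
    a n <= l <= a n + 6 * D n * e k.
  have [l fl] := window_sum_cvg (f k n) (D n) (e k) (D0 n) (e0 k) (e2 k)
    (f0 k n) (fun i _ => fD k n i).
  by rewrite /f subr0 /gauss expr0 mulr1 => lb; exists l.
pose b k n := sval (cid2 (fb k n)).
have bP k n : window_sum (f k n) @ \oo --> b k n by rewrite /b; case: cid2.
have bB k n : a n <= b k n <= a n + 6 * D n * e k by rewrite /b; case: cid2.
exists b; split=> [k|n].
  apply: (convolution_STP a (gauss (q k))) => //.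
  - exact: gauss_STP.
  - exact: bP.
  - by move=> m x xi; exact: PF_minor_neq0.
have h : a n + 6 * D n * e k @[k --> \oo] --> a n + 6 * D n * 0.
  by apply: cvgD; [exact: cvg_cst|apply: cvgM => //; exact: cvg_cst].
rewrite mulr0 addr0 in h.
by apply: (squeeze_cvgr _ (cvg_cst (a n)) h); exact: nearW.
Qed.

Theorem theorem1p2 (R : realType) :
  (forall a : int -> R, PF_seq a ->
     exists ar : nat -> int -> R,
       (forall r : nat, PF_seq (ar r) /\ STP_infty (toeplitz (ar r))) /\
       (forall n : int, ar r n @[r --> \oo] --> a n))
  /\ dense_in (@TP_PF_seq R) (@PF_seq R).
Proof.
have approx (a : int -> R) : PF_seq a -> exists b : nat -> int -> R,
    (forall r, STP_infty (toeplitz (b r))) /\ (forall n, b r n @[r --> \oo] --> a n).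
  move=> Ta.
  have [[c [r [c0 r0 aE]]]|ngeo] := pselect (exists c r : R,
      [/\ 0 <= c, 0 < r & forall n, a n = c * r ^ n]).
    by rewrite (funext aE); exact: geometric_approx.
  exact: convolution_approx.
split=> [a Ta|].
  have [b [bS ba]] := approx a Ta; exists b; split=> // r; split=> //.
  exact: STP_TN.
split=> [a|O [a Oa]]; first exact: STP_TN.
move=> [U oU UO].
have [b [bS ba]] := approx (val a) (set_valP a).
have bcvg : b @ \oo --> (val a : {ptws int -> R}).
  (* The product topology is the supremum of the topologies pulled back along the coordinates, so
     one coordinate at a time suffices. *)
  apply/cvg_sup => n V [W [oW Wa] WV].
  have [B oB BW] := oW; rewrite -BW in Wa WV.
  have : \forall r \near \oo, B (b r n) by apply: ba; exact: open_nbhs_nbhs.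
  by apply: filterS => r Br; exact: WV.
have : \forall r \near \oo, U (b r).
  apply: bcvg; apply: open_nbhs_nbhs; split=> //.
  by move: Oa; rewrite -UO.
move=> [r _ /(_ r (leqnn r)) Ur].
have Tb : PF_seq (b r) by exact: STP_TN.
by exists (SigSub (mem_set Tb)); split; [rewrite -UO|exact: bS].
Qed.
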